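(* Let $L=\mathbb{Z}^2$. Then $\delta(3)=1/2$. Moreover, every periodic set $S\subseteq L$ of density $1/2$ such that every $x\in S$ satisfies $N_S(x)\le 3$ has $N_S(x)\ge 2$ for all $x\in S$ and $N_S(y)\ge 4$ for all $y\in L\setminus S$; in particular such an $S$ is a (periodic) still Life.
   Context: Two points $x\neq y$ of $L=\mathbb{Z}^2$ are neighbors if $|x_i-y_i|\le 1$ for $i=1,2$ (so each point has 8 neighbors). For $S\subseteq L$ and $x\in L$, $N_S(x)$ is the number of neighbors of $x$ lying in $S$. Let ${\sf B}_r=\{x\in L:|x_1|,|x_2|<r\}$. The upper density of $S$ is $\limsup_{r\to\infty}|{\sf B}_r\cap S|/|{\sf B}_r|$; if the corresponding limit exists it is the density of $S$. $S$ is periodic if it is invariant under translation by some subgroup of finite index in $L$. For an integer $n\ge 0$, $\delta(n)$ denotes the supremum of the upper densities of sets $S\subseteq L$ such that $N_S(x)\le n$ for every $x\in S$. A still Life is a set $S\subseteq L$ such that: no $x\notin S$ has $N_S(x)=3$; every $x\in S$ has $N_S(x)\ge 2$; every $x\in S$ has $N_S(x)\le 3$. *)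

(* Defs.v *)
From mathcomp Require Import all_boot all_order all_algebra finmap.
From mathcomp Require Import all_classical all_reals all_analysis.

Set Implicit Arguments.
Unset Strict Implicit.
Unset Printing Implicit Defensive.

Import Order.TTheory GRing.Theory Num.Theory.
Import numFieldNormedType.Exports.

Local Open Scope classical_set_scope.
Local Open Scope ring_scope.

Notation L := (int * int)%type.

Definition neighbor (x y : L) : Prop :=
  [/\ x <> y, `|x.1 - y.1| <= 1 & `|x.2 - y.2| <= 1].

(* [fset_set] sends infinite sets to the empty set; in [N_] and [box_ratio] it is
   only applied to subsets of bounded regions, which are finite. *)
Definition N_ (S : set L) (x : L) : nat :=
  #|` fset_set [set y | S y /\ neighbor x y]|.

Definition B_ (r : nat) : set L :=
  [set x | `|x.1| < r%:Z /\ `|x.2| < r%:Z].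

(* The term r = 0, where the box is empty, is 0 / 0 = 0; all terms are in
   [0, 1], so [limn_sup] and [sup] below take their usual meaning. *)
Definition box_ratio (R : realType) (S : set L) (r : nat) : R :=
  #|` fset_set (B_ r `&` S)|%:R / #|` fset_set (B_ r)|%:R.

Definition upper_density (R : realType) (S : set L) : R :=
  limn_sup (box_ratio R S).

Definition has_density (R : realType) (S : set L) (d : R) : Prop :=
  box_ratio R S @ \oo --> d.

(* A subgroup has finite index when it has finitely many cosets. *)
Definition finite_index (H : set L) : Prop :=
  finite_set (range (fun x : L => [set x + h | h in H])).

Definition periodic_set (S : set L) : Prop :=
  exists H : set L, [/\ zmod_closed (mem H), finite_index H &
    forall h, H h -> [set x + h | x in S] = S].

Definition delta (R : realType) (n : nat) : R :=
  sup [set upper_density R S | S in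
        [set S : set L | forall x, S x -> (N_ S x <= n)%N]].

Definition still_life (S : set L) : Prop :=
  [/\ forall x, ~ S x -> N_ S x <> 3%N,
      forall x, S x -> (2 <= N_ S x)%N &
      forall x, S x -> (N_ S x <= 3)%N].

(* Main.v *)
(** Discharging on 3x3 windows.  Every cell starts with charge 1 if live and 0 if
    dead, and orthogonally adjacent cells exchange charge according to the 2x3
    block formed by the two cells and their common neighbours: essentially, a
    live cell gives 1/4 to each dead cell it touches along an edge.  Once the
    charges have moved, no cell holds more than 1/2; since the flows telescope,
    a box of side n contains at most n^2/2 + n live cells.

    If S is periodic and some cell ends with charge below 1/2, then so does a
    positive proportion of all cells and the density is below 1/2.  Hence
    density 1/2 forces charge exactly 1/2 everywhere.  This pins down the number
    of live neighbours of a cell, except around one type of dead cell with three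
    live neighbours, and there one of three nearby cells cannot have charge 1/2. *)

Require Import Defs.
From mathcomp Require Import all_boot all_order all_algebra finmap.
From mathcomp Require Import all_classical all_reals all_analysis.
From mathcomp Require Import zify ring lra.

Import Order.TTheory GRing.Theory Num.Theory.
Import numFieldNormedType.Exports.

Local Open Scope classical_set_scope.
Local Open Scope ring_scope.

(** * The discharging rule and its local quantities *)

(* What a cell receives from an orthogonal neighbour, in units of 1/12: [n2] is
   the receiving cell, [n1] and [n3] its neighbours lying alongside [f2], and
   [f1], [f2], [f3] the facing cells, [f2] being the giver.  The small amount 1
   is only there to make more of the windows strict. *)
Definition inflow (n1 n2 n3 f1 f2 f3 : bool) : nat :=
  if [|| [&& ~~ n2, f2 & ~~ (n1 && n3)] | [&& ~~ n1, n2, ~~ n3, f1, f2 & f3]]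
  then 3%N
  else nat_of_bool [&& ~~ n1, ~~ n2, ~~ n3, ~~ f2 & f1 || f3].

(** Net transfer towards the [n] side. It is antisymmetric in the two sides, so total charge is
    conserved. *)
Definition flow (n1 n2 n3 f1 f2 f3 : bool) : int :=
  (inflow n1 n2 n3 f1 f2 f3)%:Z - (inflow f1 f2 f3 n1 n2 n3)%:Z.

Lemma flowC n1 n2 n3 f1 f2 f3 :
  flow n1 n2 n3 f1 f2 f3 = - flow f1 f2 f3 n1 n2 n3.
Proof. by rewrite /flow opprB. Qed.

Lemma norm_flow_le n1 n2 n3 f1 f2 f3 : `|flow n1 n2 n3 f1 f2 f3| <= 3.
Proof. by case: n1; case: n2; case: n3; case: f1; case: f2; case: f3. Qed.

(** Reading order, with the first coordinate growing eastward and the second northward. The type [T]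
    lets the same window serve integers, counts and Booleans. *)
Definition at_window {T : Type} (P : bool -> bool -> bool -> bool -> bool ->
    bool -> bool -> bool -> bool -> T) (b : int -> int -> bool) (x y : int) : T :=
  P (b (x - 1) (y + 1)) (b x (y + 1)) (b (x + 1) (y + 1))
    (b (x - 1) y) (b x y) (b (x + 1) y)
    (b (x - 1) (y - 1)) (b x (y - 1)) (b (x + 1) (y - 1)).

(* 12 times the amount by which the final charge of the central cell falls short
   of 1/2. *)
Definition slack9 (nw n ne w c e sw s se : bool) : int :=
  6 - 12 * (c : nat)%:Z - flow n c s ne e se - flow n c s nw w sw
    - flow w c e nw n ne - flow w c e sw s se.

Definition around9 (nw n ne w c e sw s se : bool) : nat :=
  (nw + n + ne + w + e + sw + s + se)%N.

(* For the four orthogonal cells, only the neighbours visible in the window are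
   counted. *)
Definition legal9 (nw n ne w c e sw s se : bool) : bool :=
  [&& c ==> (around9 nw n ne w c e sw s se <= 3)%N,
      n ==> (nw + ne + w + c + e <= 3)%N, s ==> (sw + se + w + c + e <= 3)%N,
      w ==> (nw + sw + n + c + s <= 3)%N & e ==> (ne + se + n + c + s <= 3)%N].

Definition good9 (nw n ne w c e sw s se : bool) : bool :=
  ((if c then 2 else 4) <= around9 nw n ne w c e sw s se)%N.

Definition tight9 (nw n ne w c e sw s se : bool) : bool :=
  legal9 nw n ne w c e sw s se && (slack9 nw n ne w c e sw s se == 0).

(** * Exhaustive checks over 3x3 windows *)

Definition allb (P : bool -> bool) : bool := P true && P false.

Lemma allbP P : allb P -> forall b, P b.
Proof. by case/andP=> ? ? []. Qed.

Definition all9 (P : bool -> bool -> bool -> bool -> bool ->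
    bool -> bool -> bool -> bool -> bool) : bool :=
  allb (fun b1 => allb (fun b2 => allb (fun b3 => allb (fun b4 => allb (fun b5 =>
  allb (fun b6 => allb (fun b7 => allb (fun b8 => allb (P b1 b2 b3 b4 b5 b6 b7 b8))))))))).

Lemma all9P P : all9 P -> forall b x y, at_window P b x y.
Proof. rewrite /all9 /at_window => H b x y.
move: H => /allbP/(_ (b (x - 1) (y + 1)))/allbP/(_ (b x (y + 1))).
move=> /allbP/(_ (b (x + 1) (y + 1)))/allbP/(_ (b (x - 1) y))/allbP/(_ (b x y)).
move=> /allbP/(_ (b (x + 1) y))/allbP/(_ (b (x - 1) (y - 1))).
by move=> /allbP/(_ (b x (y - 1)))/allbP/(_ (b (x + 1) (y - 1))).
Qed.

(** Charge and legality are read off within one window, so checking all 512 windows suffices. *)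
Lemma slack9_ge0 : all9 (fun b1 b2 b3 b4 b5 b6 b7 b8 b9 =>
  legal9 b1 b2 b3 b4 b5 b6 b7 b8 b9 ==> (0 <= slack9 b1 b2 b3 b4 b5 b6 b7 b8 b9)).
Proof. by vm_compute. Qed.

(* Up to a reflection, the only tight window that is not good. *)
Definition stubborn9 (nw n ne w c e sw s se : bool) : bool :=
  [&& nw, ~~ n, ~~ ne, ~~ w, ~~ c, e, ~~ sw, s & ~~ se].

Lemma tight9_good : all9 (fun b1 b2 b3 b4 b5 b6 b7 b8 b9 =>
  tight9 b1 b2 b3 b4 b5 b6 b7 b8 b9 ==>
  [|| good9 b1 b2 b3 b4 b5 b6 b7 b8 b9,
      stubborn9 b1 b2 b3 b4 b5 b6 b7 b8 b9,
      stubborn9 b3 b2 b1 b6 b5 b4 b9 b8 b7,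
      stubborn9 b7 b8 b9 b4 b5 b6 b1 b2 b3 |
      stubborn9 b9 b8 b7 b6 b5 b4 b3 b2 b1]).
Proof. by vm_compute. Qed.

(** Swapping the outer cells on both sides of a block preserves [inflow], so the two reflections
    only permute the four flows. *)
Lemma tight9_flip : all9 (fun b1 b2 b3 b4 b5 b6 b7 b8 b9 =>
  (tight9 b1 b2 b3 b4 b5 b6 b7 b8 b9 == tight9 b3 b2 b1 b6 b5 b4 b9 b8 b7) &&
  (tight9 b1 b2 b3 b4 b5 b6 b7 b8 b9 == tight9 b7 b8 b9 b4 b5 b6 b1 b2 b3)).
Proof. by vm_compute. Qed.

(** The windows centred at the east, south and south-east cells of a stubborn window. The seven
    variables are the cells outside it: part of the column two steps east, of the row two steps
    south, and their common corner. *)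
Lemma stubborn_not_tight :
  allb (fun e1 => allb (fun e2 => allb (fun e3 => allb (fun s1 =>
  allb (fun s2 => allb (fun s3 => allb (fun se =>
  ~~ [&& tight9 false false e1 false true e2 true false e3,
         tight9 false false true false true false s1 s2 s3 &
         tight9 false true e2 true false e3 s2 s3 se]))))))).
Proof. by vm_compute. Qed.

Lemma tight_not_stubborn b : (forall x y, at_window tight9 b x y) ->
  forall x y, ~~ at_window stubborn9 b x y.
Proof.
move=> tb x y; apply/negP => /and5P[b1 /negbTE b2 /negbTE b3 /negbTE b4].
case/and5P => /negbTE b5 b6 /negbTE b7 b8 /negbTE b9.
have := stubborn_not_tight.
move=> /allbP/(_ (b (x + 1 + 1) (y + 1)))/allbP/(_ (b (x + 1 + 1) y)).
move=> /allbP/(_ (b (x + 1 + 1) (y - 1)))/allbP/(_ (b (x - 1) (y - 1 - 1))).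
move=> /allbP/(_ (b x (y - 1 - 1)))/allbP/(_ (b (x + 1) (y - 1 - 1))).
move=> /allbP/(_ (b (x + 1 + 1) (y - 1 - 1)))/negP.
apply; apply/and3P.
have := tb (x + 1) (y - 1); have := tb x (y - 1); have := tb (x + 1) y.
by rewrite /at_window !addrK ?subrK b2 b3 b4 b5 b6 b7 b8 b9.
Qed.

(** Reflecting the plane preserves tightness, and turns each of the four exceptional windows into
    the stubborn one. *)
Lemma tight_good b : (forall x y, at_window tight9 b x y) ->
  forall x y, at_window good9 b x y.
Proof.
pose fx (b : int -> int -> bool) := fun x y => b (- x) y.
pose fy (b : int -> int -> bool) := fun x y => b x (- y).
have winfx T P c x y : @at_window T P (fx c) x y =
    at_window (fun b1 b2 b3 b4 b5 b6 b7 b8 b9 => P b3 b2 b1 b6 b5 b4 b9 b8 b7) c (- x) y.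
  by rewrite /at_window /fx !opprD !opprK.
have winfy T P c x y : @at_window T P (fy c) x y =
    at_window (fun b1 b2 b3 b4 b5 b6 b7 b8 b9 => P b7 b8 b9 b4 b5 b6 b1 b2 b3) c x (- y).
  by rewrite /at_window /fy !opprD !opprK.
have tfx c : (forall x y, at_window tight9 c x y) ->
    forall x y, at_window tight9 (fx c) x y.
  move=> tc x y; rewrite winfx; have := tc (- x) y.
  by have /andP[/eqP + _] := all9P _ tight9_flip c (- x) y; rewrite /at_window => ->.
have tfy c : (forall x y, at_window tight9 c x y) ->
    forall x y, at_window tight9 (fy c) x y.
  move=> tc x y; rewrite winfy; have := tc x (- y).
  by have /andP[_ /eqP +] := all9P _ tight9_flip c x (- y); rewrite /at_window => ->.
move=> tb x y.
have /implyP/(_ (tb x y)) := all9P _ tight9_good b x y.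
case/or4P => [//|s|s|/orP[s|s]]; exfalso; move: s; apply/negP.
- exact: tight_not_stubborn tb x y.
- have := tight_not_stubborn _ (tfx _ tb) (- x) y.
  by rewrite winfx opprK.
- have := tight_not_stubborn _ (tfy _ tb) x (- y).
  by rewrite winfy opprK.
- have := tight_not_stubborn _ (tfx _ (tfy _ tb)) (- x) (- y).
  by rewrite winfx /at_window /fy /= !opprK !opprD !opprK.
Qed.

(** * Telescoping of the flows over a box *)

Definition hflow (b : int -> int -> bool) (x y : int) : int :=
  flow (b x (y + 1)) (b x y) (b x (y - 1))
    (b (x + 1) (y + 1)) (b (x + 1) y) (b (x + 1) (y - 1)).

Definition vflow (b : int -> int -> bool) (x y : int) : int :=
  flow (b (x - 1) y) (b x y) (b (x + 1) y)
    (b (x - 1) (y + 1)) (b x (y + 1)) (b (x + 1) (y + 1)).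

(** The slack in divergence form, ready for telescoping. *)
Lemma slackE b x y : at_window slack9 b x y =
  6 - 12 * (b x y : nat)%:Z - (hflow b x y - hflow b (x - 1) y)
    - (vflow b x y - vflow b x (y - 1)).
Proof.
rewrite /at_window /slack9 /hflow /vflow !subrK.
rewrite (flowC (b x (y + 1)) _ _ (b (x - 1) (y + 1))).
rewrite (flowC _ _ _ (b (x - 1) (y - 1)) (b x (y - 1))).
lia.
Qed.

Lemma norm_sum_diff_le (f : int -> int) (u : int) (c : int) (n : nat) :
  (forall x, `|f x| <= c) ->
  `|\sum_(0 <= i < n) (f (u + i%:Z) - f (u + i%:Z - 1))| <= 2 * c.
Proof.
move=> fc; rewrite (eq_bigr (fun i => f (u + i.+1%:Z - 1) - f (u + i%:Z - 1))).
  rewrite (telescope_sumr (fun i => f (u + i%:Z - 1)))//.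
  by rewrite mulr_natl mulr2n (le_trans (ler_normB _ _)) ?lerD.
by move=> i _; congr (f _ - _); lia.
Qed.

Definition box_sum (u v : int) (n : nat) (f : int -> int -> int) : int :=
  \sum_(0 <= i < n) \sum_(0 <= j < n) f (u + i%:Z) (v + j%:Z).

(** Only the flows across the boundary survive: [4 * n] edges, each carrying at most 3. *)
Lemma box_sum_slack b u v n :
  `|box_sum u v n (at_window slack9 b) -
    (6 * n%:Z ^+ 2 - 12 * box_sum u v n (fun x y => (b x y : nat)%:Z))|
  <= 12 * n%:Z.
Proof.
have norm_sum (g : nat -> int) : (forall i, `|g i| <= 6) ->
    `|\sum_(0 <= i < n) g i| <= 6 * n%:Z.
  move=> g6; rewrite (le_trans (ler_norm_sum _ _ _))// (le_trans (ler_sum _ (fun i _ => g6 i)))//.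
  by rewrite sumr_const_nat subn0 -[leLHS]mulr_natr (natz n).
have split (B H V : nat -> nat -> int) :
    \sum_(0 <= i < n) \sum_(0 <= j < n) (6 - 12 * B i j - H i j - V i j) =
    6 * n%:Z ^+ 2 - 12 * (\sum_(0 <= i < n) \sum_(0 <= j < n) B i j)
    - \sum_(0 <= i < n) \sum_(0 <= j < n) H i j
    - \sum_(0 <= i < n) \sum_(0 <= j < n) V i j.
  under eq_bigr => i _ do rewrite !sumrB -mulr_sumr.
  rewrite !sumrB -mulr_sumr; congr (_ - _ - _ - _).
  by rewrite !sumr_const_nat !subn0 -[LHS]mulr_natr -[X in X * _]mulr_natr (natz n) expr2 mulrA.
rewrite /box_sum.
under eq_bigr => i _ do under eq_bigr => j _ do rewrite slackE.
rewrite (split (fun i j => (b (u + i%:Z) (v + j%:Z) : nat)%:Z)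
  (fun i j => hflow b (u + i%:Z) (v + j%:Z) - hflow b (u + i%:Z - 1) (v + j%:Z))
  (fun i j => vflow b (u + i%:Z) (v + j%:Z) - vflow b (u + i%:Z) (v + j%:Z - 1))).
set A := 6 * _ - _; set H := \sum_(0 <= i < n) _; set V := \sum_(0 <= i < n) _.
have HB : `|H| <= 6 * n%:Z.
  (* Horizontal flows telescope in [i], hence the exchange of sums. *)
  rewrite /H exchange_big; apply: norm_sum => j.
  by apply: (norm_sum_diff_le (hflow b ^~ (v + j%:Z)) u 3) => x; exact: norm_flow_le.
have VB : `|V| <= 6 * n%:Z.
  apply: norm_sum => i.
  by apply: (norm_sum_diff_le (vflow b (u + i%:Z)) v 3) => x; exact: norm_flow_le.
have -> : A - H - V - A = - (H + V) by ring.
rewrite normrN (le_trans (ler_normD _ _))// (le_trans (lerD HB VB))//.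
by rewrite -mulrDl.
Qed.

Lemma sum_progression_le (f : nat -> int) (m p k n : nat) :
  (forall i, 0 <= f i) -> (0 < p)%N -> (m + p * k <= n)%N ->
  \sum_(0 <= i < k) f (m + p * i)%N <= \sum_(0 <= i < n) f i.
Proof.
move=> f0 p0 mn.
rewrite (big_cat_nat (leq0n _) mn)/= ler_wpDr ?sumr_ge0//.
elim: k {mn} => [|k IH]; first by rewrite big_nil sumr_ge0.
have lt_mk : (m + p * k < m + p * k.+1)%N by rewrite mulnS; lia.
rewrite big_nat_recr//= (big_cat_nat (leq0n _) (ltnW lt_mk))/=.
apply: lerD => //; rewrite big_ltn//.
by rewrite ler_wpDr ?sumr_ge0.
Qed.

(** Used to turn one periodically repeated non-tight cell into a loss quadratic in the side of the
    box. *)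
Lemma box_sum_ge (f : int -> int -> int) u v (m m' p k n : nat) :
  (forall x y, 0 <= f x y) -> (0 < p)%N ->
  (m + p * k <= n)%N -> (m' + p * k <= n)%N ->
  (forall i j : nat, 1 <= f (u + (m + p * i)%N%:Z) (v + (m' + p * j)%N%:Z)) ->
  k%:Z ^+ 2 <= box_sum u v n f.
Proof.
move=> f0 p0 mn mn' f1; rewrite /box_sum.
apply: le_trans (sum_progression_le _ m p k n _ p0 mn); last first.
  by move=> i; apply: sumr_ge0.
apply: (@le_trans _ _ (\sum_(0 <= i < k) k%:Z)).
  by rewrite sumr_const_nat subn0 -[leRHS]mulr_natr (natz k) expr2.
apply: ler_sum => i _.
apply: le_trans (sum_progression_le (fun j => f _ (v + j%:Z)) m' p k n _ p0 mn') => //.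
apply: (@le_trans _ _ (\sum_(0 <= j < k) 1)).
  by rewrite sumr_const_nat subn0 natz.
by apply: ler_sum.
Qed.

(** * Neighbour counts and box cardinalities as explicit sums *)

Lemma card_fset_set_seq (T : choiceType) (s : seq T) (A : set T) : uniq s ->
  #|` fset_set [set y | A y /\ y \in s]| = count (fun y => `[< A y >]) s.
Proof.
move=> us; rewrite -size_filter.
have -> : [set y | A y /\ y \in s] = [set` [fset y in seq.filter (fun y => `[< A y >]) s]%fset].
  apply/seteqP; split => y /=; rewrite inE mem_filter; first by case=> /asboolP -> ->.
  by case/andP => /asboolP.
by rewrite set_fsetK card_fseq undup_id// filter_uniq.
Qed.

Definition ind (S : set L) (x y : int) : bool := `[< S (x, y) >].

Lemma N_E S x y : N_ S (x, y) = at_window around9 (ind S) x y.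
Proof.
pose s := [:: (x - 1, y + 1); (x, y + 1); (x + 1, y + 1); (x - 1, y);
  (x + 1, y); (x - 1, y - 1); (x, y - 1); (x + 1, y - 1)].
have -> : N_ S (x, y) = #|` fset_set [set z | S z /\ z \in s]|.
  rewrite /N_; congr #|` fset_set _|; apply/seteqP.
  split => -[u v] [Suv /= H]; split => //; move: H.
    case=> /= ne; rewrite !inE !xpair_eqE => *.
    have {ne} : ~~ ((u == x) && (v == y)).
      by apply/negP => /andP[/eqP ux /eqP vy]; apply: ne; rewrite ux vy.
    lia.
  rewrite !inE !xpair_eqE => H; split=> /=; [|lia|lia].
  by case=> ? ?; lia.
rewrite card_fset_set_seq /=; last by rewrite !inE !xpair_eqE; lia.
by rewrite /at_window /around9 /ind addn0 !addnA.
Qed.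

(** The side of [B_ r]; truncation gives 0 for the empty box [r = 0]. *)
Definition box_size (r : nat) : nat := (2 * r).-1.

Lemma card_box r (S : set L) : #|` fset_set (B_ r `&` S)|%:Z =
  box_sum (1 - r%:Z) (1 - r%:Z) (box_size r) (fun x y => (ind S x y : nat)%:Z).
Proof.
pose s := [seq 1 - r%:Z + i%:Z | i <- iota 0 (box_size r)].
have sE x : (x \in s) = (`|x| < r%:Z).
  apply/mapP/idP => [[i + ->]|xr]; first by rewrite mem_iota /box_size; lia.
  exists (absz (x - (1 - r%:Z))%R); last by lia.
  by rewrite mem_iota /box_size; lia.
have us : uniq s by rewrite map_inj_uniq ?iota_uniq// => i j; lia.
have -> : B_ r `&` S = [set y | S y /\ y \in [seq (x, y) | x <- s, y <- s]].
  apply/seteqP; split => -[x y] /=.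
    by case=> -[/= xr yr] Sxy; split => //; apply/allpairsP; exists (x, y); rewrite /= !sE.
  case=> Sxy /allpairsP[[u v]]/= [+ + [eu ev]]; rewrite !sE => ur vr; subst u v.
  by split; [split|].
rewrite card_fset_set_seq; last by apply: allpairs_uniq => // -[? ?] [? ?] _ _.
rewrite -sum1_count big_mkcond big_allpairs big_map -natz natr_sum.
rewrite /box_sum /index_iota subn0; apply: eq_bigr => i _.
rewrite big_map natr_sum; apply: eq_bigr => j _.
by rewrite natz /ind; case: asboolP.
Qed.

Lemma card_B r : #|` fset_set (B_ r)| = (box_size r ^ 2)%N.
Proof.
apply/eqP; rewrite -eqz_nat -[B_ r]setIT card_box /box_sum /ind.
under eq_bigr => i _ do under eq_bigr => j _ do rewrite asboolT//=.
rewrite !sumr_const_nat !subn0 -[X in X *+ _]mulr_natr -[eqbLHS]mulr_natr !natz.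
by rewrite mul1r -PoszM mulnn.
Qed.

Definition legal (S : set L) : Prop := forall x, S x -> (N_ S x <= 3)%N.

(** What the window shows of an orthogonal cell's neighbours is part of its full count. *)
Lemma legal_at_window S : legal S -> forall x y, at_window legal9 (ind S) x y.
Proof.
move=> lS; have lN u v : ind S u v -> (at_window around9 (ind S) u v <= 3)%N.
  by move/asboolP => Suv; rewrite -N_E lS.
move=> x y; have := lN x y; have := lN x (y + 1); have := lN x (y - 1).
have := lN (x - 1) y; have := lN (x + 1) y.
rewrite /at_window /legal9 /around9 !addrK ?subrK => He Hw Hs Hn Hc.
apply/and5P; split; apply/implyP => H; [exact: Hc|
  apply: leq_trans (Hn H)|apply: leq_trans (Hs H)|
  apply: leq_trans (Hw H)|apply: leq_trans (He H)]; clear; lia.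
Qed.

Lemma slack_ge0 S x y : legal S -> 0 <= at_window slack9 (ind S) x y.
Proof.
move=> lS; have /implyP := all9P _ slack9_ge0 (ind S) x y; apply.
exact: legal_at_window.
Qed.

Lemma box_sum_slack_card S r : let n := box_size r in
  `|box_sum (1 - r%:Z) (1 - r%:Z) n (at_window slack9 (ind S)) -
    (6 * n%:Z ^+ 2 - 12 * #|` fset_set (B_ r `&` S)|%:Z)| <= 12 * n%:Z.
Proof. by rewrite card_box; exact: box_sum_slack. Qed.

Lemma card_box_le S r : legal S ->
  (2 * #|` fset_set (B_ r `&` S)| <= box_size r ^ 2 + 2 * box_size r)%N.
Proof.
move=> lS; have := box_sum_slack_card S r => /=.
have : 0 <= box_sum (1 - r%:Z) (1 - r%:Z) (box_size r) (at_window slack9 (ind S)).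
  by apply: sumr_ge0 => i _; apply: sumr_ge0 => j _; exact: slack_ge0.
move: (box_sum _ _ _ _) => B.
rewrite expr2 -mulnn; lia.
Qed.

Lemma card_box_ge S r : (forall x y, at_window slack9 (ind S) x y = 0) ->
  (box_size r ^ 2 <= 2 * #|` fset_set (B_ r `&` S)| + 2 * box_size r)%N.
Proof.
move=> S0; have := box_sum_slack_card S r => /=.
have -> : box_sum (1 - r%:Z) (1 - r%:Z) (box_size r) (at_window slack9 (ind S)) = 0.
  by rewrite /box_sum big1// => i _; rewrite big1.
rewrite expr2 -mulnn; lia.
Qed.

(** * Densities and the value of [delta R 3] *)

Section Density.
Context (R : realType).

Lemma box_ratioE S r :
  box_ratio R S r = #|` fset_set (B_ r `&` S)|%:R / (box_size r)%:R ^+ 2.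
Proof. by rewrite /box_ratio card_B natrX. Qed.

Lemma box_sizeV r : (0 < r)%N -> (box_size r)%:R^-1 <= 2 * harmonic r :> R.
Proof.
(* [harmonic r] is [1 / (r + 1)], and [r + 1 <= 2 * (2 * r - 1)] once [r >= 1]. *)
move=> r0; have nr : (r.+1 <= 2 * box_size r)%N by rewrite /box_size; lia.
have n0 : (0 < box_size r)%N by lia.
rewrite /harmonic/= -[leLHS]mul1r ler_pdivrMr ?ltr0n// mulrAC ler_pdivlMr ?ltr0n//.
by rewrite mul1r -natrM ler_nat.
Qed.

Lemma box_ratio_le S r : legal S -> box_ratio R S r <= 1 / 2 + 2 * harmonic r.
Proof.
(* For [r = 0] the ratio is 0 by the convention on division. *)
move=> lS; case: (posnP r) => [->|r0].
  rewrite box_ratioE /box_size muln0/= expr2 mulr0 invr0 mulr0.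
  by rewrite addr_ge0// mulr_ge0// harmonic_ge0.
apply: le_trans (lerD (lexx _) (box_sizeV _ r0)).
have n0 : 0 < (box_size r)%:R :> R by rewrite ltr0n /box_size; lia.
rewrite box_ratioE ler_pdivrMr ?exprn_gt0//.
have := card_box_le S r lS; rewrite -mulnn -(ler_nat R) natrD !natrM -expr2 => H.
have -> : (1 / 2 + (box_size r)%:R^-1) * (box_size r)%:R ^+ 2 =
    (box_size r)%:R ^+ 2 / 2 + (box_size r)%:R :> R by field; rewrite gt_eqF.
lra.
Qed.

Lemma box_ratio_ge S r : (forall x y, at_window slack9 (ind S) x y = 0) ->
  1 / 2 - 2 * harmonic r <= box_ratio R S r.
Proof.
move=> S0; case: (posnP r) => [->|r0].
  by rewrite box_ratioE /box_size muln0/= expr2 mulr0 invr0 mulr0; lra.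
apply: (@le_trans _ _ (1 / 2 - (box_size r)%:R^-1)).
  by rewrite lerD2l lerN2 box_sizeV.
have n0 : 0 < (box_size r)%:R :> R by rewrite ltr0n /box_size; lia.
rewrite box_ratioE ler_pdivlMr ?exprn_gt0//.
have := card_box_ge S r S0; rewrite -mulnn -(ler_nat R) natrD !natrM -expr2 => H.
have -> : (1 / 2 - (box_size r)%:R^-1) * (box_size r)%:R ^+ 2 =
    (box_size r)%:R ^+ 2 / 2 - (box_size r)%:R :> R by field; rewrite gt_eqF.
lra.
Qed.

Lemma box_ratio_ge0 S r : 0 <= box_ratio R S r.
Proof. by rewrite /box_ratio divr_ge0. Qed.

Lemma cvg_addr_harmonic (l c : R) : (fun r => l + c * harmonic r) @ \oo --> l.
Proof.
rewrite -[X in _ --> X]addr0 -[X in _ + X](mulr0 c).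
by apply: cvgD; [exact: cvg_cst|apply: cvgMr; exact: cvg_harmonic].
Qed.

(** The tail suprema of [u] lie below those of [v], which tend to [l]; boundedness of [u] makes its
    own tail suprema converge. *)
Lemma limn_sup_le_cvg (u v : R^o^nat) (l : R) : has_lbound (range u) ->
  (forall n, u n <= v n) -> v @ \oo --> (l : R^o) -> limn_sup u <= l.
Proof.
move=> ulb uv vl.
have vcvg : cvgn v by apply/cvg_ex; exists l.
have vub : has_ubound (range v) by exact/bounded_fun_has_ubound/cvg_seq_bounded.
have uub : has_ubound (range u).
  by case: vub => M vM; exists M => _ [n _ <-]; rewrite (le_trans (uv n))// vM//; exists n.
have <- : limn (sups v) = l by apply/cvg_lim => //; exact: cvg_sups.
apply: ler_lim; [|exact: is_cvg_sups|].
  by apply/cvg_ex; exists (inf (range (sups u))); exact: cvg_sups_inf.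
apply: nearW => n; apply: ge_sup; first by exists (u n); exists n => /=.
move=> _ [k /= nk <-]; rewrite (le_trans (uv k))// ub_le_sup//; last by exists k.
exact: has_ubound_sdrop.
Qed.

Lemma upper_density_le S : legal S -> upper_density R S <= 1 / 2.
Proof.
move=> lS; apply: limn_sup_le_cvg (cvg_addr_harmonic _ 2).
  by exists 0 => _ [n _ <-]; exact: box_ratio_ge0.
by move=> n; exact: box_ratio_le.
Qed.

Lemma tight_has_density S : legal S ->
  (forall x y, at_window slack9 (ind S) x y = 0) -> has_density S (1 / 2 : R).
Proof.
move=> lS S0.
apply: (squeeze_cvgr _ (cvg_addr_harmonic (1 / 2) (- 2)) (cvg_addr_harmonic (1 / 2) 2)).
by apply: nearW => r; rewrite box_ratio_le// mulNr box_ratio_ge.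
Qed.

(** The extremal example: every other column is live, and every window is tight. *)
Definition stripes : set L := [set x | (2 %| x.1)%Z].

Lemma ind_stripes x y : ind stripes x y = (2 %| x)%Z.
Proof. by rewrite /ind asboolb. Qed.

Lemma stripes_window T P x y : @at_window T P (ind stripes) x y =
  let c := (2 %| x)%Z in P (~~ c) c (~~ c) (~~ c) c (~~ c) (~~ c) c (~~ c).
Proof.
rewrite /at_window !ind_stripes.
by have [-> ->] : (2 %| x - 1)%Z = ~~ (2 %| x)%Z /\ (2 %| x + 1)%Z = ~~ (2 %| x)%Z by split; lia.
Qed.

Lemma legal_stripes : legal stripes.
Proof.
move=> [x y] /= xy; rewrite N_E stripes_window.
by have -> : (2 %| x)%Z = true.
Qed.

Lemma slack_stripes x y : at_window slack9 (ind stripes) x y = 0.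
Proof. by rewrite stripes_window/=; case: (2 %| x)%Z. Qed.

Lemma delta3 : delta R 3 = 1 / 2.
Proof.
have ub : ubound [set upper_density R S | S in [set S | legal S]] (1 / 2).
  by move=> _ [S lS <-]; exact: upper_density_le.
have mem : [set upper_density R S | S in [set S | legal S]] (1 / 2).
  exists stripes; first exact: legal_stripes.
  have := tight_has_density _ legal_stripes slack_stripes.
  by move/cvg_limn_inf_sup => [].
apply/eqP; rewrite eq_le; apply/andP; split.
  by apply: ge_sup => //; exists (1 / 2).
by apply: ub_le_sup => //; exists (1 / 2).
Qed.

End Density.

(** * Periodic sets of density 1/2 *)

(** Pigeonhole: two multiples of [e] share a coset, and their difference lies in [H]. *)
Lemma finite_index_mulrn (H : set L) (e : L) : H 0 -> finite_index H ->
  exists2 a : nat, (0 < a)%N & H (e *+ a).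
Proof.
move=> H0 fH.
pose coset (x : L) := [set x + h | h in H].
have [k1 [k2 [lt12 eq12]]] : exists k1 k2 : nat,
    (k1 < k2)%N /\ coset (e *+ k1) = coset (e *+ k2).
  apply: contrapT => inj; apply: infinite_nat.
  have -> : [set: nat] = (fun k : nat => coset (e *+ k)) @^-1` range coset.
    by apply/seteqP; split => // k _; exists (e *+ k).
  apply: finite_preimage fH => k1 k2 _ _ eq12.
  by have [lt12|lt21|//] := ltngtP k1 k2; exfalso; apply: inj; [exists k1, k2|exists k2, k1].
exists (k2 - k1)%N; first by rewrite subn_gt0.
have : coset (e *+ k2) (e *+ k2) by exists 0; rewrite ?addr0.
rewrite -eq12 => -[h Hh he]; suff <- : h = e *+ (k2 - k1) by [].
by apply: (@addrI _ (e *+ k1)); rewrite he -mulrnDr subnKC// ltnW.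
Qed.

Lemma periodic_ind S : periodic_set S -> exists2 p : nat, (0 < p)%N &
  forall x y (i j : nat), ind S (x + (p * i)%N%:Z) (y + (p * j)%N%:Z) = ind S x y.
Proof.
move=> [H [[H0 HB] fH HS]].
have {}H0 : H 0 by move: H0; rewrite inE.
have {}HB h h' : H h -> H h' -> H (h - h').
  by move=> /mem_set Hh /mem_set Hh'; move: (HB _ _ Hh Hh'); rewrite inE.
have HD h h' : H h -> H h' -> H (h + h').
  by move=> Hh Hh'; rewrite -[h']opprK -[- h']sub0r; exact: (HB _ _ Hh (HB _ _ H0 Hh')).
have HM h k : H h -> H (h *+ k).
  by move=> Hh; elim: k => [//|k IH]; rewrite mulrS; exact: HD.
have indH (u v : int) h : H h -> ind S (u + h.1) (v + h.2) = ind S u v.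
  move=> Hh; apply: asbool_equiv_eq; split=> [Suv|Suv].
    have : [set x + h | x in S] (u + h.1, v + h.2) by rewrite HS.
    by case=> -[u' v'] Suv' /= [/addIr <- /addIr <-].
  by rewrite -(HS _ Hh); exists (u, v).
have [a a0 Ha] := finite_index_mulrn H (1, 0) H0 fH.
have [b b0 Hb] := finite_index_mulrn H (0, 1) H0 fH.
(* [H] contains [(a, 0)] and [(0, b)], so [a * b] is a period in both directions. *)
exists (a * b)%N => [|x y i j]; first by rewrite muln_gt0 a0.
have pairM (u v : int) k : (u, v) *+ k = (u *+ k, v *+ k).
  by elim: k => [//|k IH]; rewrite !mulrS IH.
rewrite -[RHS](indH _ _ _ (HD _ _ (HM _ (b * i)%N Ha) (HM _ (a * j)%N Hb))).
rewrite !pairM /= !mul0rn addr0 add0r -!mulrnA !natz.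
by rewrite mulnA -[(b * (a * j))%N]mulnCA mulnA.
Qed.

Lemma tight_of_periodic (R : realType) S : periodic_set S ->
  has_density S (1 / 2 : R) -> legal S -> forall x y, at_window slack9 (ind S) x y = 0.
Proof.
move=> /periodic_ind[p p0 Sp] dS lS x y.
apply/eqP; rewrite -[_ == 0]negbK; apply/negP => slack_neq0.
(* The slack is a nonnegative integer, so nonzero means at least 1, and periodicity copies it. *)
have slack1 i j : 1 <= at_window slack9 (ind S) (x + (p * i)%N%:Z) (y + (p * j)%N%:Z).
  have -> : at_window slack9 (ind S) (x + (p * i)%N%:Z) (y + (p * j)%N%:Z) =
      at_window slack9 (ind S) x y.
    by rewrite /at_window ![_ + _ - 1]addrAC ![_ + _ + 1]addrAC !Sp.
  have := slack_ge0 S x y lS; move: slack_neq0; lia.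
(* With this margin, the box of radius [c + p * k] contains [k ^ 2] translates of the bad cell. *)
pose c := (absz x + absz y).+1.
have gap k : (c <= k)%N -> (96 * p <= k)%N -> let r := (c + p * k)%N in
    (192 * p ^ 2 * (2 * #|` fset_set (B_ r `&` S)|) + box_size r ^ 2 <=
     192 * p ^ 2 * box_size r ^ 2)%N.
  move=> ck pk /=; set r := (c + p * k)%N.
  set n := box_size r; set N := #|` _|.
  have n_le : (n <= 4 * (p * k))%N by have := leq_pmull k p0; rewrite /n /box_size /r; lia.
  have shift z i : `|z| < r%:Z ->
      1 - r%:Z + (absz (z - (1 - r%:Z))%R + p * i)%N%:Z = z + (p * i)%N%:Z.
    by move=> zr; lia.
  have k2 : k%:Z ^+ 2 <= box_sum (1 - r%:Z) (1 - r%:Z) n (at_window slack9 (ind S)).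
    apply: (@box_sum_ge _ _ _ (absz (x - (1 - r%:Z))%R) (absz (y - (1 - r%:Z))%R) p k).
    - by move=> u v; exact: slack_ge0.
    - by [].
    - by rewrite /n /box_size /r /c; lia.
    - by rewrite /n /box_size /r /c; lia.
    - by move=> i j; rewrite !shift ?slack1// /r /c; lia.
  have := box_sum_slack_card S r => /=.
  rewrite -/n -/N; move: k2; move: (box_sum _ _ _ _) => B.
  rewrite !expr2 => k2 BN.
  (* The loss [k ^ 2] is doubled with the rest of the inequality; one copy will absorb the boundary
     term [24 * n], the other dominates [n ^ 2 / (16 * p ^ 2)]. *)
  have le1 : (12 * (2 * N) + 2 * k ^ 2 <= 12 * n ^ 2 + 24 * n)%N.
    by rewrite -!mulnn; lia.
  have le2 : (24 * n <= k ^ 2)%N.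
    by rewrite -mulnn (leq_trans (_ : _ <= 96 * p * k)%N) ?leq_mul2r ?pk ?orbT//; lia.
  have le3 : (n ^ 2 <= 16 * p ^ 2 * k ^ 2)%N.
    by rewrite -mulnA -!expnMn -[16%N]/(4 ^ 2)%N -expnMn leq_sqr.
  have le4 : (12 * (2 * N) + k ^ 2 <= 12 * n ^ 2)%N by lia.
  have := leq_mul (leqnn (16 * p ^ 2)) le4; move: le3; clear.
  by move: (p ^ 2)%N (k ^ 2)%N (n ^ 2)%N => q K M; lia.
(* Dividing [gap] by [384 * p ^ 2 * n ^ 2], with [n] the box side, keeps the ratio at least this far
   below 1/2. *)
have e0 : 0 < (384 * p ^ 2)%N%:R^-1 :> R by rewrite invr_gt0 ltr0n muln_gt0 expn_gt0 p0.
move/cvgrPdist_lt : dS => /(_ _ e0)[m _ close].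
(* Large enough for both conditions of [gap] and for [r] to pass the threshold [m]. *)
pose k := (c + 96 * p + m)%N; pose r := (c + p * k)%N.
have := close r; apply/not_implyP; split; first by have := leq_pmull k p0; rewrite /= /r /k; lia.
apply/negP; rewrite -leNgt box_ratioE.
have n0 : 0 < (box_size r)%:R :> R by rewrite ltr0n /box_size /r /c; lia.
have q0 : 0 < p%:R :> R by rewrite ltr0n.
have /(_ _ _)/= := gap k; rewrite -/r.
have ck : (c <= k)%N by rewrite /k; lia.
have pk : (96 * p <= k)%N by rewrite /k; lia.
move=> /(_ ck pk); rewrite -!mulnn -(ler_nat R) natrD !natrM.
move: (box_size r)%:R n0 p%:R q0 => n n0 q q0; set N := #|` _|%:R => H.
rewrite ler_normr; apply/orP; left.
rewrite lerBrDr -lerBrDl ler_pdivrMr ?exprn_gt0//.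
rewrite -(ler_pM2l (_ : 0 < 384 * q ^+ 2)) ?mulr_gt0 ?exprn_gt0//.
have -> : 384 * q ^+ 2 * ((1 / 2 - (384 * (q * q))^-1) * n ^+ 2) =
   192 * q ^+ 2 * n ^+ 2 - n ^+ 2 by field; rewrite gt_eqF.
rewrite !expr2; lra.
Qed.

Theorem mainTheorem1 (R : realType) :
  delta R 3 = 1 / 2 /\
  forall S : set L,
    periodic_set S -> has_density S (1 / 2 : R) ->
    (forall x : L, S x -> (N_ S x <= 3)%N) ->
    [/\ forall x : L, S x -> (2 <= N_ S x)%N,
        forall y : L, ~ S y -> (4 <= N_ S y)%N &
        periodic_set S /\ still_life S].
Proof.
split=> [|S pS dS lS]; first exact: delta3.
have good x y : at_window good9 (ind S) x y.
  apply: tight_good => u v; apply/andP; split; first exact: legal_at_window.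
  by apply/eqP; exact: (tight_of_periodic R).
have alive x : S x -> (2 <= N_ S x)%N.
  by case: x => x y Sxy; have := good x y; rewrite N_E /at_window /good9 {1}/ind asboolT.
have dead y : ~ S y -> (4 <= N_ S y)%N.
  by case: y => x y Sxy; have := good x y; rewrite N_E /at_window /good9 {1}/ind asboolF.
by split=> //; split=> //; split=> // x /dead; case: (N_ S x) => [|[|[|[]]]].
Qed.
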